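(* Let $k\ge2$ be a fixed integer. There is a constant $c(k)>0$, depending only on $k$, such that the following holds. Let $N\ge1$ be an integer, let $\lambda_1,\dots,\lambda_N$ be real numbers, let $f(1),\dots,f(N)$ be complex numbers, and put $F(x)=\sum_{n\le N}f(n)e^{2\pi i\lambda_nx}$ for $x\in\mathbb{R}$. Let $L,M$ be positive integers with $M\le N$ and let $\mathcal{M}\subseteq\{1,\dots,N\}$ be a set of cardinality $M$. Let $\delta=\delta(L,N,\mathcal{M})$ be the minimum of $$\left|j\lambda_n+\sum_{m\in\mathcal{M}}\ell_m\lambda_m\right|$$ over all $n\in\{1,\dots,N\}$, all $j\in\{0,1\}$ and all integers $\ell_m\in[-L,L]$ ($m\in\mathcal{M}$) with $(j,(\ell_m)_{m\in\mathcal{M}})\ne(0,\dots,0)$, excluding those choices for which the linear form $jX_n+\sum_{m\in\mathcal{M}}\ell_mX_m$ in independent indeterminates $X_1,\dots,X_N$ vanishes identically (that is, excluding the choices $n\in\mathcal{M}$, $j=1$, $\ell_n=-1$, $\ell_m=0$ for $m\in\mathcal{M}\setminus\{n\}$). If $\delta>0$, then for any real $T\ge1$, $$\max_{x\in[T,2T]}\Re(F(x))\;\ge\;\frac{L}{L+1}\sum_{m\in\mathcal{M}}|f(m)|-\frac{c(k)}{(\delta T)^k}\sum_{n\le N}|f(n)|.$$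
   Context: $\Re$ denotes the real part. *)

(* Defs.v *)
From HB Require Import structures.
From mathcomp Require Import all_boot all_order all_algebra.
From mathcomp Require Import complex.
From mathcomp Require Import all_classical all_reals all_analysis.
(* Only the instances: its notations clash with those of mathcomp-analysis. *)
From mathcomp Require Import (canonicals) mpoly.
Set Implicit Arguments.
Unset Strict Implicit.
Unset Printing Implicit Defensive.
Import Order.TTheory GRing.Theory Num.Theory.
Local Open Scope classical_set_scope.
Local Open Scope ring_scope.
Local Open Scope complex_scope.

Definition is_min (R : realType) (A : set R) (x : R) := A x /\ lbound A x.

Definition is_max (R : realType) (A : set R) (x : R) := A x /\ ubound A x.

(* e^{i t} for real t *)
Definition expi (R : realType) (t : R) : R[i] := cos t +i* sin t.

Definition trig_sum (R : realType) (N : nat) (lam : 'I_N -> R)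
    (f : 'I_N -> R[i]) (x : R) : R[i] :=
  \sum_(n < N) f n * expi (2 * pi * lam n * x).

(* j X_n + \sum_(m in A) l_m X_m, with j : bool standing for j in {0, 1}; only
   the values of l on A matter.  It is used both at real numbers and at the
   indeterminates of a polynomial ring. *)
Definition lin_form (V : zmodType) (N : nat) (A : {set 'I_N}) (X : 'I_N -> V)
    (n : 'I_N) (j : bool) (l : 'I_N -> int) : V :=
  X n *+ j + \sum_(m in A) X m *~ l m.

Definition indet (N : nat) (i : 'I_N) : mpoly.mpoly N int :=
  mpoly.mpolyX int (mpoly.mnm1 i).

Definition admissible (N : nat) (L : nat) (A : {set 'I_N})
    (n : 'I_N) (j : bool) (l : 'I_N -> int) : Prop :=
  [/\ forall m, m \in A -> - L%:Z <= l m <= L%:Z,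
      j \/ exists2 m, m \in A & l m != 0
    & lin_form A (@indet N) n j l != 0].

Definition form_values (R : realType) (N : nat) (lam : 'I_N -> R) (L : nat)
    (A : {set 'I_N}) : set R :=
  [set v | exists n j l,
      admissible L A n j l /\ v = `|lin_form A lam n j l|].

(* Main.v *)
Require Import Defs.
From mathcomp Require Import all_boot all_order all_algebra.
From mathcomp Require Import complex.
From mathcomp Require Import all_classical all_reals all_analysis.
From mathcomp Require Import (canonicals) mpoly.
From mathcomp Require Import zify ring lra.
Import Order.TTheory GRing.Theory Num.Theory.
Import numFieldNormedType.Exports.
Local Open Scope classical_set_scope.
Local Open Scope ring_scope.
Local Open Scope complex_scope.
Set Implicit Arguments.
Unset Strict Implicit.
Unset Printing Implicit Defensive.

(** The lower bound comes from averaging [Re F] over points of [[T, 2T]]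
against a nonnegative weight that resonates with the frequencies [lam m],
[m] in [A].

The weight is [|Q|^2] for the trigonometric polynomial
[Q(y) = \prod_(m in A) \sum_(0 <= l <= L) u_m^l e(l lam_m y)], where
[e(t) = exp(2 pi i t)] and the unimodular [u_m] satisfy
[f(m) * conj u_m = |f(m)|]; up to a scalar it is a product of Fejer kernels.
Expanding the product indexes the terms of [Q] by the set [G] of multi-indices
[phi], with frequencies [nu phi].  A difference [nu phi - nu psi] is a form
with coefficients in [[-L, L]], so the hypothesis on [delta] says that distinct
frequencies of [Q] are [delta]-separated, and that each number
[lam n + nu phi - nu psi] is at least [delta] in absolute value unless the form
vanishes identically, that is unless [n] is in [A] and [psi] is [phi] raised by
one at [n].  For [n] in [A] a proportion [L / L.+1] of all [phi] can be raised
at [n], and each such resonant pair contributes exactly [|f n|]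
([resonance]).

The averages are finite sums over points [x_p = T + s (p_1 + ... + p_k)], a
discretised k-fold convolution of the uniform density on an interval of length
[T / k].  The average of [e(t x)] is then the k-th power of a normalised
geometric sum, bounded by [(k / (|t| T))^k] as long as the step [s] is small
compared to [1 / |t|] ([sampling_points]).  Only finitely many frequencies
occur, so one step suits them all and no integral is needed.

The number of pairs [(phi, psi)] is exponentially large in [M], but for a fixed
[psi] the non-resonant values [mu + nu phi - nu psi] are [delta]-separated and
at distance at least [delta] from 0.  As [k >= 2], the sum over [phi] of their
[(delta / |.|)^k] is at most 4 ([separated_sum]).  Hence the average of
[|Q|^2 e(mu x)] is its resonant part up to an error [eps |G|] with
[eps = 4 k^k / (delta T)^k] ([sampled_square_approx]).

With [mu = 0] this says that the weight has total mass [|G| (1 + O(eps))]; with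
[mu = lam n], summed against [f n], it bounds the weighted average of [Re F]
from below by [|G| (L / L.+1 \sum_(m in A) |f m| - eps \sum_n |f n|)].  That
average is at most the maximum [V] times the mass, and [|V| <= \sum_n |f n|],
so replacing the mass by [|G|] costs another [eps \sum_n |f n|]; this gives
the constant [8 k^k]. *)

(** * Complex moduli and exponentials *)

Lemma normc_sum (R : realType) (I : Type) (r : seq I) (P : pred I)
    (F : I -> R[i]) :
  Normc.normc (\sum_(i <- r | P i) F i) <=
  \sum_(i <- r | P i) Normc.normc (F i).
Proof.
elim/big_rec2: _ => [|i y z _ yz]; first by rewrite Normc.normc0.
by apply: (le_trans (le_normcD _ _)); rewrite lerD2l.
Qed.

Lemma abs_Re_le (R : realType) (z : R[i]) :
  `|complex.Re z| <= Normc.normc z.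
Proof. by have := normc_ge_Re z; rewrite -[`|z|]/((Normc.normc z)%:C) lecR. Qed.

Lemma normc_ge0 (R : realType) (z : R[i]) : 0 <= Normc.normc z.
Proof. by case: z => a b; exact: sqrtr_ge0. Qed.

Lemma normcX (R : realType) (z : R[i]) n :
  Normc.normc (z ^+ n) = Normc.normc z ^+ n.
Proof.
elim: n => [|n IH]; first by rewrite !expr0 Normc.normc1.
by rewrite !exprS Normc.normcM IH.
Qed.

Lemma mulcJ (R : realType) (z : R[i]) : z * z^* = (Normc.normc z ^+ 2)%:C.
Proof. by rewrite -sqr_normc -[`|z|]/((Normc.normc z)%:C) rmorphXn. Qed.

Lemma normcRe (R : realType) (a : R) : Normc.normc a%:C = `|a|.
Proof. by rewrite /Normc.normc /= expr0n addr0 sqrtr_sqr. Qed.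

Lemma expiD (R : realType) (s t : R) : expi (s + t) = expi s * expi t.
Proof. by rewrite /expi cosD sinD; simpc; congr (_ +i* _); rewrite addrC. Qed.

Lemma expi0 (R : realType) : expi (0 : R) = 1.
Proof. by rewrite /expi cos0 sin0. Qed.

Lemma expiN (R : realType) (t : R) : expi (- t) = (expi t)^*%R.
Proof. by rewrite /expi cosN sinN. Qed.

Lemma normc_expi (R : realType) (t : R) : Normc.normc (expi t) = 1.
Proof. by rewrite /expi /Normc.normc cos2Dsin2 sqrtr1. Qed.

Lemma normc_conj (R : realType) (z : R[i]) :
  Normc.normc (z^*%R) = Normc.normc z.
Proof. by case: z => a b; rewrite /Normc.normc /= sqrrN. Qed.

Lemma expi_sum (R : realType) (I : Type) (r : seq I) (P : pred I) (F : I -> R) :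
  expi (\sum_(i <- r | P i) F i) = \prod_(i <- r | P i) expi (F i).
Proof. by apply: (big_morph _ (@expiD R) (@expi0 R)). Qed.

Lemma expiMn (R : realType) (t : R) n : expi (t *+ n) = expi t ^+ n.
Proof.
elim: n => [|n IH]; first by rewrite mulr0n expi0.
by rewrite mulrS expiD IH exprS.
Qed.

Lemma ReD (R : realType) (z w : R[i]) :
  complex.Re (z + w) = complex.Re z + complex.Re w.
Proof. by case: z w => a b [c d]. Qed.

Lemma Re_sum (R : realType) (I : Type) (r : seq I) (P : pred I) (F : I -> R[i]) :
  complex.Re (\sum_(i <- r | P i) F i) = \sum_(i <- r | P i) complex.Re (F i).
Proof. by apply: (big_morph _ (@ReD R)). Qed.

Lemma ReMl (R : realType) (a : R) (z : R[i]) :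
  complex.Re (a%:C * z) = a * complex.Re z.
Proof. by case: z => b c; rewrite /= mul0r subr0. Qed.

(** The real part is continuous, and [[T, 2T]] is a segment. *)
Lemma trig_max (R : realType) N (lam : 'I_N -> R) (f : 'I_N -> R[i]) (T : R) :
  0 < T ->
  exists V, is_max [set complex.Re (trig_sum lam f x) | x in `[T, 2 * T]] V.
Proof.
move=> T0.
have ReE x : complex.Re (trig_sum lam f x) = \sum_n
    (complex.Re (f n) * cos (2 * pi * lam n * x) -
     complex.Im (f n) * sin (2 * pi * lam n * x)).
  rewrite /trig_sum (big_morph (@complex.Re R) (id1 := 0) (op1 := +%R)) //.
    by apply: eq_bigr => n _; case: (f n).
  by case=> a b [].
have cont : continuous (fun x => complex.Re (trig_sum lam f x)).
  move=> x; under eq_fun => y do rewrite ReE.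
  apply: cvg_big => [|n _ /=]; first exact: add_continuous.
  have c : (2 * pi * lam n * y) @[y --> x] --> 2 * pi * lam n * x.
    by apply: cvgM; [exact: cvg_cst | exact: cvg_id].
  apply: cvgB; apply: cvgM; try exact: cvg_cst.
    exact: (continuous_cvg _ (@continuous_cos R _) c).
  exact: (continuous_cvg _ (@continuous_sin R _) c).
have T2 : T <= 2 * T by lra.
have [x0 x0I x0max] := EVT_max T2 (continuous_subspaceT cont).
exists (complex.Re (trig_sum lam f x0)); split; first by exists x0.
by move=> _ [x xI <-]; exact: x0max.
Qed.

(** * Averaging exponentials over sample points *)

(** By the mean value theorem, since [cos] exceeds 1/2 near 0.  It makes the
geometric sums below decay like [1 / |t|]. *)
Lemma sin_near0 (R : realType) :
  exists2 r : R, 0 < r & forall u, `|u| <= r -> `|u| / 2 <= `|sin u|.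
Proof.
have c0 : cos x @[x --> (0 : R)] --> (1 : R).
  by rewrite -(cos0 R); exact: continuous_cos.
have : \forall x \near (0 : R), 1 / 2 < cos x.
  by apply: (cvgr_gt _ c0); lra.
case/nbhs_ballP => r /= r0 hr.
exists (r / 2); first by rewrite divr_gt0.
move=> u ur.
wlog u0 : u ur / 0 <= u.
  move=> H; case: (leP 0 u) => [/H|u0]; first exact.
  rewrite -normrN -[`|sin u|]normrN -sinN; apply: H; last by lra.
  by rewrite normrN.
have [->|un0] := eqVneq u 0; first by rewrite normr0 mul0r normr_ge0.
have up : 0 < u by rewrite lt_neqAle eq_sym un0.
have [x] := MVT up (fun x _ => is_derive_sin x)
  (continuous_subspaceT (@continuous_sin R)).
rewrite sin0 !subr0 => xI ->; rewrite normrM mulrC ler_wpM2r //.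
have xu := itvP xI.
have /hr : ball 0 r x.
  by rewrite /ball /= sub0r normrN ger0_norm ?xu //; move: ur;
    rewrite (ger0_norm u0) => ur; apply: (@lt_le_trans _ _ u); rewrite ?xu //; lra.
move=> cx; rewrite ger0_norm; lra.
Qed.

(** Telescoping: the sum times [expi t - 1] is [expi (t *+ n) - 1], and [sin t]
is the imaginary part of [expi t - 1]. *)
Lemma geometric_expi (R : realType) (t : R) n :
  Normc.normc (\sum_(j < n) expi (t *+ j)) * `|sin t| <= 2.
Proof.
have -> : \sum_(j < n) expi (t *+ j) = \sum_(j < n) expi t ^+ j.
  by apply: eq_bigr => j _; rewrite expiMn.
have h : `|sin t| <= Normc.normc (expi t - 1).
  rewrite /expi /Normc.normc /= subr0 -sqrtr_sqr ler_wsqrtr //.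
  by rewrite lerDr sqr_ge0.
apply: (le_trans (ler_wpM2l (normc_ge0 _) h)).
rewrite -Normc.normcM mulrC -subrX1.
apply: (le_trans (le_normcD _ _)).
by rewrite normcN normcX normc_expi expr1n Normc.normc1.
Qed.

(** The points are [T + s (p_1 + ... + p_k)] with [s = T / (k n)] and
[0 <= p_i < n], so that the exponential sum factors as the k-th power of a
geometric sum with ratio [expi (2 pi t s)].  The bound [B] on the frequencies
is what allows a single [n] to bring every angle [2 pi t s] into the range of
[sin_near0]. *)
Lemma sampling_points (R : realType) (k : nat) (T B : R) :
    (0 < k)%N -> 0 < T ->
  exists (P : finType) (x : P -> R),
    [/\ (0 < #|P|)%N, forall p, x p \in `[T, 2 * T] &
        forall t, t != 0 -> `|t| <= B ->
          Normc.normc (\sum_p expi (2 * pi * t * x p)) <=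
          #|P|%:R * (k%:R / (`|t| * T)) ^+ k].
Proof.
move=> k0 T0; have [r r0 sin_ge] := sin_near0 R.
have kR : 0 < k%:R :> R by rewrite ltr0n.
have pi0 := pi_gt0 R; have pi2 := pi_ge2 R.
pose n := (Num.truncn (2 * pi * B * T / r)).+1.
have nR : 0 < n%:R :> R by rewrite ltr0n.
pose s : R := T / (k * n)%:R.
have sE : s = T / (k%:R * n%:R) by rewrite /s natrM.
clearbody s; have s0 : 0 < s by rewrite sE divr_gt0 // mulr_gt0.
exists {ffun 'I_k -> 'I_n}, (fun p : {ffun 'I_k -> 'I_n} => T + \sum_i s *+ p i); split.
- by rewrite card_ffun !card_ord expn_gt0.
- move=> p; rewrite in_itv /=; apply/andP; split.
    by rewrite lerDl; apply: sumr_ge0 => i _; rewrite mulrn_wge0 // ltW.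
  rewrite mulr_natl mulr2n lerD2l.
  have -> : T = \sum_(i < k) s *+ n.
    rewrite sumr_const card_ord -mulrnA -[s *+ _]mulr_natr natrM sE; field.
    by rewrite !gt_eqF.
  by apply: ler_sum => i _; rewrite ler_wpMn2l ?ltW // ltnW.
move=> t t0 tB; set th := 2 * pi * t * s.
have -> : \sum_(p : {ffun 'I_k -> 'I_n})
      expi (2 * pi * t * (T + \sum_i s *+ p i)) =
    expi (2 * pi * t * T) * (\sum_(j < n) expi (th *+ j)) ^+ k.
  have -> : (\sum_(j < n) expi (th *+ j)) ^+ k =
     \prod_(i < k) \sum_(j < n) expi (th *+ j) by rewrite prodr_const card_ord.
  rewrite bigA_distr_bigA mulr_sumr; apply: eq_bigr => p _.
  rewrite mulrDr expiD mulr_sumr expi_sum; congr (_ * _).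
  by apply: eq_bigr => i _; rewrite mulrnAr.
rewrite Normc.normcM normc_expi mul1r normcX card_ffun !card_ord natrX.
rewrite -exprMn lerXn2r ?nnegrE ?normc_ge0 //.
  by rewrite mulr_ge0 ?divr_ge0 ?mulr_ge0 // ltW.
have tp : 0 < `|t| by rewrite normr_gt0.
have thE : `|th| = 2 * pi * `|t| * s.
  by rewrite /th !normrM (gtr0_norm s0) (gtr0_norm pi0) ger0_norm.
have thr : `|th| <= r.
  rewrite thE.
  apply: (@le_trans _ _ (2 * pi * B * s)).
    by rewrite ler_pM2r // ler_pM2l // mulr_gt0.
  have h : 2 * pi * B * T / r < n%:R.
    by rewrite /n truncnS_gt.
  rewrite ltr_pdivrMr // in h.
  rewrite sE mulrA ler_pdivrMr ?mulr_gt0 //.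
  apply: (le_trans (ltW h)); rewrite mulrC ler_pM2l //.
  by apply: ler_peMl; [exact: ltW | rewrite ler1n].
have H : Normc.normc (\sum_(j < n) expi (th *+ j)) * (`|th| / 2) <= 2.
  apply: (le_trans _ (geometric_expi th n)).
  by rewrite ler_wpM2l ?normc_ge0 ?sin_ge.
have thp : 0 < `|th| by rewrite thE !mulr_gt0.
rewrite -(ler_pM2r (x := `|th| / 2)); last by rewrite divr_gt0.
apply: (le_trans H); rewrite thE sE.
have -> : n%:R * (k%:R / (`|t| * T)) * (2 * pi * `|t| * (T / (k%:R * n%:R)) / 2)
   = pi :> R by field; rewrite !gt_eqF.
exact: pi_ge2.
Qed.

(** * Sums over separated points *)

(** The term [q = 0]is 0, inversion being total. *)
Lemma sum_inv_square (R : realType) n :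
  \sum_(q < n) (q%:R : R) ^- 2 <= 2.
Proof.
(* The telescoping bound 1/(n+1)^2 <= 1/n - 1/(n+1) drives the induction. *)
suff: \sum_(q < n.+1) (q%:R : R) ^- 2 <= 2 - n%:R^-1.
  rewrite big_ord_recr /= => h.
  have inv_ge0 : 0 <= n%:R^-1 :> R by rewrite invr_ge0.
  have sqr_ge0 : 0 <= (n%:R : R) ^- 2 by rewrite invr_ge0 exprn_ge0.
  apply: (le_trans _ (le_trans h _)); first by rewrite lerDl.
  by rewrite gerBl.
elim: n => [|n IH]; first by rewrite big_ord1 /= mulr0n expr0n /= !invr0 subr0.
case: n IH => [|n] IH.
  by rewrite !big_ord_recl big_ord0 /= mulr0n expr0n expr1n invr0 !invr1; lra.
rewrite big_ord_recr /=; apply: (le_trans (lerD IH (lexx _))).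
have a0 : 0 < n.+1%:R :> R by rewrite ltr0n.
rewrite -[n.+2%:R]natr1; move: (n.+1%:R : R) a0 => a a0.
rewrite -subr_ge0.
have -> : 2 - (a + 1)^-1 - (2 - a^-1 + (a + 1) ^- 2) = (a * (a + 1) ^+ 2)^-1.
  by field; rewrite !gt_eqF //; lra.
by rewrite invr_ge0 mulr_ge0 ?exprn_ge0 //; lra.
Qed.

(** The pair formed by the sign of [t i] and the integer part of [|t i| / d]
determines [i]: two indices with the same pair have [|t i - t j| < d].  The sum
is therefore at most two copies of the sum of [q^-2] over [q >= 1]. *)
Lemma separated_sum (R : realType) (I : finType) (S : {pred I}) (t : I -> R)
    (d : R) (k : nat) :
    (2 <= k)%N -> 0 < d ->
    {in S, forall i, d <= `|t i|} ->
    {in S &, forall i j, i != j -> d <= `|t i - t j|} ->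
  \sum_(i in S) (d / `|t i|) ^+ k <= 4.
Proof.
move=> k2 d0 far sep.
pose u i := `|t i| / d.
have u1 i : i \in S -> 1 <= u i by move=> /far; rewrite ler_pdivlMr ?mul1r.
pose q i := Num.truncn (u i).
have qle i : (q i)%:R <= u i by rewrite truncn_le divr_ge0 // ltW.
have qgt i : u i < (q i)%:R + 1 by rewrite natr1 truncnS_gt.
have q1 i : i \in S -> (0 < q i)%N.
  by move=> /u1 h; rewrite truncn_gt0.
pose m := \max_(i in S) q i.
pose h i : bool * 'I_m.+1 := (0 <= t i, inord (q i)).
have hq i : i \in S -> (h i).2 = q i :> nat.
  by move=> iS; rewrite /h inordK // ltnS leq_bigmax_cond.
have h_inj : {in S &, injective h}.
  move=> i j iS jS hij.
  suff lt_d : `|t i - t j| < d.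
    by apply/eqP; apply: contraLR lt_d => ne; rewrite -leNgt sep.
  have qij : q i = q j by rewrite -(hq i) // -(hq j) // hij.
  have sgn : (0 <= t i) = (0 <= t j) by case: hij.
  have ltd i1 j1 : q i1 = q j1 -> `|t i1| - `|t j1| < d.
    move=> e; have := qgt i1; have := qle j1; rewrite e => h1 h2.
    have : u i1 - u j1 < 1 by lra.
    by rewrite /u -mulrBl ltr_pdivrMr // mul1r.
  have := ltd _ _ qij; have := ltd _ _ (esym qij).
  case: (leP 0 (t i)) sgn => ti /esym; [move=> tj | move=> /negbT; rewrite -ltNge => tj].
    rewrite (ger0_norm ti) (ger0_norm tj) => h1 h2.
    by case: (ger0P (t i - t j)); lra.
  rewrite (ltr0_norm ti) (ltr0_norm tj) => h1 h2.
  by case: (ger0P (t i - t j)); lra.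
pose G (p : bool * 'I_m.+1) : R := (p.2%:R) ^- 2.
apply: (@le_trans _ _ (\sum_(i in S) G (h i))).
  apply: ler_sum => i iS; rewrite /G hq //.
  have q0 : 0 < (q i)%:R :> R by rewrite ltr0n q1.
  have ui : 0 < u i by apply: (lt_le_trans ltr01 (u1 _ iS)).
  have -> : d / `|t i| = (u i)^-1 by rewrite /u invf_div.
  rewrite -!exprVn; apply: (@le_trans _ _ ((u i)^-1 ^+ 2)).
    by apply: ler_wiXn2l; rewrite ?invr_ge0 ?invf_le1 ?u1 // ltW.
  by rewrite lerXn2r ?nnegrE ?invr_ge0 ?lef_pV2 ?posrE // ltW.
rewrite -(big_imset G h_inj).
apply: (@le_trans _ _ (\sum_p G p)).
  rewrite [leRHS](bigID (mem (h @: S))) /= lerDl.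
  by apply: sumr_ge0 => p _; rewrite invr_ge0 exprn_ge0.
rewrite -(pair_bigA _ (fun b j => G (b, j))) /= big_bool /=.
by have := sum_inv_square R m.+1; rewrite /G /=; lra.
Qed.

(** * Averages of squared trigonometric polynomials *)

Definition trig_poly (R : realType) (I : finType) (G : {set I}) (z : I -> R[i])
    (nu : I -> R) (y : R) : R[i] :=
  \sum_(i in G) z i * expi (2 * pi * nu i * y).

Lemma sampled_square (R : realType) (P I : finType) (x : P -> R) (G : {set I})
    (z : I -> R[i]) (nu : I -> R) (mu : R) :
  \sum_p (Normc.normc (trig_poly G z nu (x p)) ^+ 2)%:C *
    expi (2 * pi * mu * x p) =
  \sum_(j in G) \sum_(i in G) z i * (z j)^* *
    \sum_p expi (2 * pi * (mu + nu i - nu j) * x p).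
Proof.
under eq_bigr => p _.
  rewrite -mulcJ /trig_poly rmorph_sum mulrC mulr_sumr mulr_sumr.
  under eq_bigr => j _ do rewrite mulr_suml mulr_sumr.
  over.
rewrite exchange_big; apply: eq_bigr => j _ /=.
rewrite exchange_big; apply: eq_bigr => i _ /=.
rewrite mulr_sumr; apply: eq_bigr => p _.
have -> : 2 * pi * (mu + nu i - nu j) * x p =
  2 * pi * mu * x p + 2 * pi * nu i * x p - 2 * pi * nu j * x p by ring.
by rewrite rmorphM /= -expiN !expiD; ring.
Qed.

(** The resonant pairs, those with [mu + nu i - nu j = 0], are summed exactly;
for each [j] the other ones are controlled by [separated_sum], which is why the
error grows like [#|G|] and not like its square. *)
Lemma sampled_square_approx (R : realType) (P I : finType) (x : P -> R)
    (G : {set I}) (z : I -> R[i]) (nu : I -> R) (mu : R)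
    (k : nat) (T B d : R) :
    (2 <= k)%N -> 0 < T -> 0 < d ->
    (forall t, t != 0 -> `|t| <= B ->
       Normc.normc (\sum_p expi (2 * pi * t * x p)) <=
       #|P|%:R * (k%:R / (`|t| * T)) ^+ k) ->
    {in G, forall i, Normc.normc (z i) = 1} ->
    {in G &, forall i j, i != j -> d <= `|nu i - nu j|} ->
    {in G &, forall i j, mu + nu i - nu j != 0 ->
       d <= `|mu + nu i - nu j| <= B} ->
  Normc.normc
    (\sum_p (Normc.normc (trig_poly G z nu (x p)) ^+ 2)%:C *
        expi (2 * pi * mu * x p)
     - #|P|%:R * \sum_(j in G) \sum_(i in G | mu + nu i - nu j == 0)
        z i * (z j)^*) <=
  #|P|%:R * #|G|%:R * (4 * k%:R ^+ k / (d * T) ^+ k).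
Proof.
move=> k2 T0 d0 decay z1 sep far.
rewrite sampled_square mulr_sumr -sumrB.
apply: (le_trans (normc_sum _ _ _)).
rewrite mulrAC mulr_natr -[_ *+ #|G|]sumr_const; apply: ler_sum => j jG.
rewrite (bigID (fun i => mu + nu i - nu j == 0)) /=.
have -> : \sum_(i in G | mu + nu i - nu j == 0)
    z i * (z j)^* * \sum_p expi (2 * pi * (mu + nu i - nu j) * x p) =
    #|P|%:R * \sum_(i in G | mu + nu i - nu j == 0) z i * (z j)^*.
  rewrite mulr_sumr; apply: eq_bigr => i /andP[_ /eqP ->].
  under eq_bigr => p _ do rewrite mulr0 mul0r expi0.
  by rewrite sumr_const mulrC.
rewrite addrAC subrr add0r.
pose S := [pred i | (i \in G) && (mu + nu i - nu j != 0)].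
pose t i := mu + nu i - nu j.
apply: (le_trans (normc_sum _ _ _)).
apply: (@le_trans _ _ (\sum_(i in S)
   #|P|%:R * (k%:R / (d * T)) ^+ k * (d / `|t i|) ^+ k)).
  apply: ler_sum => i /andP[iG ti0].
  have /andP[dt tB] := far _ _ iG jG ti0.
  have tp : 0 < `|t i| by exact: lt_le_trans dt.
  rewrite !Normc.normcM z1 // mul1r.
  rewrite normc_conj z1 // mul1r; apply: (le_trans (decay _ ti0 tB)).
  rewrite -mulrA -exprMn ler_wpM2l // le_eqVlt; apply/orP; left; apply/eqP.
  by congr (_ ^+ _); field; rewrite !gt_eqF.
rewrite -mulr_sumr -mulrA ler_wpM2l //.
have sum4 : \sum_(i in S) (d / `|t i|) ^+ k <= 4.
  apply: separated_sum => //.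
    by move=> i /andP[iG ti0]; have /andP[] := far _ _ iG jG ti0.
  move=> i i' /andP[iG _] /andP[i'G _] /(sep _ _ iG i'G).
  by congr (_ <= `|_|); rewrite /t; ring.
apply: (le_trans (ler_wpM2l _ sum4)).
  by rewrite exprn_ge0 // divr_ge0 // mulr_ge0 // ltW.
by rewrite expr_div_n mulrC mulrA.
Qed.

(** * Linear forms and multi-indices *)

(** Evaluation of the indeterminates at [X].  It is used at the real
frequencies, where it shows that an identically vanishing form has value 0, and
at unit vectors of integers, where it reads off coefficients. *)
Lemma lin_form_mmap (V : comNzRingType) (N : nat) (A : {set 'I_N})
    (X : 'I_N -> V) n j l :
  lin_form A X n j l =
  mpoly.mmap intr X (lin_form A (@indet N) n j l).
Proof.
have mmap_indet i : mpoly.mmap intr X (indet i) = X i.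
  by rewrite /indet mpoly.mmapX mpoly.mmap1U.
rewrite /lin_form raddfD raddfMn raddf_sum /= mmap_indet; congr (_ + _).
by apply: eq_bigr => m _; rewrite raddfMz /= mmap_indet.
Qed.

Lemma lin_form_indet_eq0 N (A : {set 'I_N}) n j l :
    lin_form A (@indet N) n j l = 0 ->
  forall m, (m == n)%:R *+ j + (if m \in A then l m else 0) = 0 :> int.
Proof.
move=> form0 m.
have := lin_form_mmap A (fun i => (m == i)%:R : int) n j l.
rewrite form0 raddf0 => E; rewrite -[RHS]E /lin_form; congr (_ + _).
case: ifP => mA.
  rewrite (bigD1 m) //= eqxx intz big1 ?addr0 // => i /andP[_ im].
  by rewrite eq_sym (negPf im) mul0rz.
by rewrite big1 // => i iA; case: eqP mA => [->|_ _]; rewrite ?iA ?mul0rz.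
Qed.

(** The exponents outside [A] are pinned to 0, so that distinct multi-indices
differ at some index in [A]. *)
Definition multi_index N (L : nat) (A : {set 'I_N}) :
    {set {ffun 'I_N -> 'I_L.+1}} :=
  [set phi | phi \in pffun_on ord0 A predT].

Definition frequency (R : realType) N (lam : 'I_N -> R) L (A : {set 'I_N})
    (phi : {ffun 'I_N -> 'I_L.+1}) : R :=
  \sum_(m in A) lam m *+ phi m.

Lemma multi_indexP N L (A : {set 'I_N}) (phi : {ffun 'I_N -> 'I_L.+1}) :
  reflect (forall m, m \notin A -> phi m = ord0) (phi \in multi_index L A).
Proof.
rewrite inE; apply: (iffP pffun_onP) => [[/supportP + _]|phi0].
  by move=> phi0 m /phi0.
by split=> //; apply/supportP.
Qed.

Lemma lin_form_frequency (R : realType) N (lam : 'I_N -> R) L (A : {set 'I_N})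
    n (j : bool) (phi psi : {ffun 'I_N -> 'I_L.+1}) :
  lin_form A lam n j (fun m => (phi m)%:Z - (psi m)%:Z) =
  lam n *+ j + frequency lam A phi - frequency lam A psi.
Proof.
rewrite /lin_form -addrA /frequency -sumrB; congr (_ + _).
by apply: eq_bigr => m _; rewrite mulrzBr.
Qed.

Lemma form_ge_delta (R : realType) N (lam : 'I_N -> R) L (A : {set 'I_N})
    (d : R) n (j : bool) (phi psi : {ffun 'I_N -> 'I_L.+1}) :
    is_min (form_values lam L A) d ->
    let l m := (phi m)%:Z - (psi m)%:Z in
    j \/ (exists2 m, m \in A & phi m != psi m) ->
    lin_form A (@indet N) n j l != 0 ->
  d <= `|lam n *+ j + frequency lam A phi - frequency lam A psi|.
Proof.
move=> [_ d_min] l nz form0; rewrite -lin_form_frequency.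
apply: d_min; exists n, j, l; split=> //; split=> //.
  by move=> m _; have := ltn_ord (phi m); have := ltn_ord (psi m); rewrite /l; lia.
case: nz => [->|[m mA ne]]; [by left | right; exists m => //].
by rewrite subr_eq0 eqz_nat.
Qed.

Lemma frequency_separated (R : realType) N (lam : 'I_N -> R) L
    (A : {set 'I_N}) (d : R) :
    (0 < N)%N -> is_min (form_values lam L A) d ->
  {in multi_index L A &, forall phi psi, phi != psi ->
    d <= `|frequency lam A phi - frequency lam A psi|}.
Proof.
move=> N0 d_min phi psi /multi_indexP phi0 /multi_indexP psi0 ne.
have [m ne_m] : exists m, phi m != psi m.
  apply/existsP; apply: contraR ne; rewrite negb_exists => /forallP eq.
  by apply/eqP/ffunP => m; apply/eqP; rewrite -[_ == _]negbK.
have mA : m \in A by apply: contraR ne_m => mA; rewrite phi0 ?psi0.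
have := @form_ge_delta _ _ lam L A d (Ordinal N0) false phi psi d_min.
rewrite mulr0n add0r; apply; first by right; exists m.
apply: contra ne_m => /eqP/lin_form_indet_eq0/(_ m).
by rewrite mulr0n add0r mA => /subr0_eq[]/val_inj/eqP.
Qed.

(** An identically vanishing form is the only way for a shifted difference of
frequencies to be small. *)
Lemma shifted_frequency (R : realType) N (lam : 'I_N -> R) L
    (A : {set 'I_N}) (d : R) n (phi psi : {ffun 'I_N -> 'I_L.+1}) :
    is_min (form_values lam L A) d ->
  (lam n + frequency lam A phi - frequency lam A psi = 0 /\
   lin_form A (@indet N) n true (fun m => (phi m)%:Z - (psi m)%:Z) = 0) \/
  d <= `|lam n + frequency lam A phi - frequency lam A psi|.
Proof.
move=> d_min.
have := @form_ge_delta _ _ lam L A d n true phi psi d_min.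
case: (eqVneq (lin_form A (@indet N) n true
  (fun m => (phi m)%:Z - (psi m)%:Z)) 0) => [form0 _|ne H]; last first.
  by right; apply: H => //; left.
left; split=> //; rewrite -[lam n]mulr1n -[1%N]/(true : nat) -lin_form_frequency.
by rewrite lin_form_mmap form0 raddf0.
Qed.

Lemma frequency_le (R : realType) N (lam : 'I_N -> R) L (A : {set 'I_N})
    (phi : {ffun 'I_N -> 'I_L.+1}) :
  `|frequency lam A phi| <= L%:R * \sum_n `|lam n|.
Proof.
rewrite [\sum_n _](bigID (mem A)) /= mulrDr -[leLHS]addr0 lerD //; last first.
  by rewrite mulr_ge0 ?sumr_ge0.
apply: (le_trans (ler_norm_sum _ _ _)); rewrite mulr_sumr; apply: ler_sum => m _.
by rewrite normrMn -[_ *+ _]mulr_natl ler_wpM2r // ler_nat -ltnS.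
Qed.

(** Both cardinals are products over [A] that differ in the factor at [n]
alone, [L] against [L.+1]. *)
Lemma card_below_max N L (A : {set 'I_N}) n : n \in A ->
  (#|[set phi in multi_index L A | phi n != ord_max]| * L.+1 =
   #|multi_index L A| * L)%N.
Proof.
move=> nA.
pose F m : {pred 'I_L.+1} := if m == n then predC1 ord_max else predT.
have -> : #|multi_index L A| = (\prod_(m in A) L.+1)%N.
  by rewrite cardsE card_pffun_on prod_nat_const cardT size_enum_ord.
have -> : #|[set phi in multi_index L A | phi n != ord_max]| =
    (\prod_(m in A) #|F m|)%N.
  have <- : foldr muln 1%N [seq #|F m| | m in A] = (\prod_(m in A) #|F m|)%N.
    by rewrite foldrE big_map big_enum.
  rewrite -(card_pfamily ord0) cardsE.
  apply: eq_card => phi; rewrite inE.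
  apply/andP/pfamilyP => [[/multi_indexP phi0 ne] | [/supportP phi0 fam]].
    by split=> [|m _]; [exact/supportP | rewrite /F; case: eqP => // ->].
  by split; [exact/multi_indexP | have := fam _ nA; rewrite /F eqxx].
rewrite !(bigD1 n nA) /= /F eqxx cardC1 card_ord -pred_Sn.
have -> : (\prod_(i in A | i != n) #|if i == n then predC1 (@ord_max L) else predT| =
    \prod_(i in A | i != n) L.+1)%N.
  by apply: eq_bigr => m /andP[_ /negPf ->]; rewrite cardT size_enum_ord.
by rewrite -mulnA mulnC [(_ * L.+1)%N]mulnC.
Qed.

Lemma paired_index (R : realType) N (lam : 'I_N -> R) L (A : {set 'I_N})
    (d : R) n (phi psi : {ffun 'I_N -> 'I_L.+1}) :
    is_min (form_values lam L A) d -> 0 < d ->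
    lam n + frequency lam A phi - frequency lam A psi = 0 ->
  n \in A /\ {in A, forall m, psi m = (phi m + (m == n))%N :> nat}.
Proof.
move=> d_min d0 eq0.
case: (shifted_frequency n phi psi d_min) => [[_]|]; last first.
  by rewrite eq0 normr0 leNgt d0.
move=> /lin_form_indet_eq0 coord; split.
  by have := coord n; rewrite eqxx; case: ifP.
by move=> m mA; have := coord m; rewrite mA mulr1n; case: (m == n) => /=; lia.
Qed.

Definition raise N L (n : 'I_N) (phi : {ffun 'I_N -> 'I_L.+1}) :
    {ffun 'I_N -> 'I_L.+1} :=
  [ffun m => if m == n then inord (phi n).+1 else phi m].

Lemma ltn_not_max L (i : 'I_L.+1) : i != ord_max -> (i.+1 < L.+1)%N.
Proof.
move=> ne; rewrite ltn_neqAle ltn_ord andbT eqSS; apply: contra ne => /eqP iL.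
exact/eqP/val_inj.
Qed.

(** Only the term at [n] changes, by exactly [lam n]. *)
Lemma raiseP (R : realType) N (lam : 'I_N -> R) L (A : {set 'I_N}) n
    (phi : {ffun 'I_N -> 'I_L.+1}) :
    n \in A -> phi n != ord_max -> phi \in multi_index L A ->
  raise n phi \in multi_index L A /\
  lam n + frequency lam A phi - frequency lam A (raise n phi) = 0.
Proof.
move=> nA nmax /multi_indexP phi0; split.
  apply/multi_indexP => m mA; rewrite ffunE; case: eqP => [mn|_]; last exact: phi0.
  by rewrite mn nA in mA.
have lt_max : ((phi n).+1 < L.+1)%N.
  exact: ltn_not_max.
rewrite /frequency (bigD1 n nA) [in X in _ - X](bigD1 n nA) /= ffunE eqxx inordK //.
rewrite [in X in _ - X](eq_bigr (fun m => lam m *+ phi m)).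
  by rewrite mulrS addrA subrr.
by move=> m /andP[_ /negPf mn]; rewrite ffunE mn.
Qed.

(** * Resonant pairs *)

Definition phase (R : realType) N L (A : {set 'I_N}) (u : 'I_N -> R[i])
    (phi : {ffun 'I_N -> 'I_L.+1}) : R[i] :=
  \prod_(m in A) u m ^+ phi m.

Lemma normc_phase (R : realType) N L (A : {set 'I_N}) (u : 'I_N -> R[i])
    (phi : {ffun 'I_N -> 'I_L.+1}) :
  (forall m, Normc.normc (u m) = 1) -> Normc.normc (phase A u phi) = 1.
Proof.
move=> u1; rewrite (big_morph _ (@Normc.normcM R) (Normc.normc1 R)).
by apply: big1 => m _; rewrite normcX u1 expr1n.
Qed.

Lemma paired_phase (R : realType) N L (A : {set 'I_N}) (u : 'I_N -> R[i]) n
    (phi psi : {ffun 'I_N -> 'I_L.+1}) :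
    (forall m, Normc.normc (u m) = 1) -> n \in A ->
    {in A, forall m, psi m = (phi m + (m == n))%N :> nat} ->
  phase A u phi * (phase A u psi)^*%R = (u n)^*%R.
Proof.
move=> u1 nA psiE.
have -> : phase A u psi = phase A u phi * u n.
  rewrite /phase !(bigD1 n nA) /= psiE // eqxx addn1 exprSr mulrAC.
  congr (_ * _ * _); apply: eq_bigr => m /andP[mA /negPf mn].
  by rewrite psiE // mn addn0.
by rewrite rmorphM /= mulrA mulcJ normc_phase // expr1n mul1r.
Qed.

(** Each resonant pair contributes [normc a], and at least the pairs
[(phi, raise n phi)] with [phi n] below its maximum occur; when [n] is outside
[A] no pair is resonant. *)
Lemma resonance (R : realType) N (lam : 'I_N -> R) L (A : {set 'I_N})
    (d : R) (u : 'I_N -> R[i]) n (a : R[i]) :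
    is_min (form_values lam L A) d -> 0 < d ->
    (forall m, Normc.normc (u m) = 1) ->
    a * (u n)^*%R = (Normc.normc a)%:C ->
  #|multi_index L A|%:R *
    (if n \in A then L%:R / L.+1%:R * Normc.normc a else 0) <=
  complex.Re (a * \sum_(psi in multi_index L A)
    \sum_(phi in multi_index L A |
        lam n + frequency lam A phi - frequency lam A psi == 0)
      phase A u phi * (phase A u psi)^*%R).
Proof.
move=> d_min d0 u1 aE; set G := multi_index L A.
pose hit (phi psi : {ffun 'I_N -> 'I_L.+1}) :=
  lam n + frequency lam A phi - frequency lam A psi == 0.
have -> : a * \sum_(psi in G) \sum_(phi in G | hit phi psi)
      phase A u phi * (phase A u psi)^*%R =
    (\sum_(psi in G) \sum_(phi in G | hit phi psi) Normc.normc a)%:C.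
  rewrite mulr_sumr rmorph_sum; apply: eq_bigr => psi _ /=.
  rewrite mulr_sumr rmorph_sum; apply: eq_bigr => phi /andP[_ /eqP eq0] /=.
  have [nA psiE] := paired_index d_min d0 eq0.
  by rewrite (paired_phase u1 nA psiE).
(* Summing over the lower index first turns the count of pairs into a count of
   the phi that can be raised. *)
rewrite /= (exchange_big_dep (mem G)) /=; last by move=> ? ? _ /andP[].
case: ifP => nA; last first.
  rewrite mulr0; apply: sumr_ge0 => *; apply: sumr_ge0 => *.
  exact: normc_ge0.
apply: (@le_trans _ _ (\sum_(phi in [set phi in G | phi n != ord_max])
    Normc.normc a)).
  rewrite sumr_const -[leRHS]mulr_natl mulrA ler_wpM2r ?normc_ge0 //.
  rewrite mulrA ler_pdivrMr ?ltr0n // -!natrM ler_nat.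
  by rewrite (card_below_max L nA).
rewrite [leRHS](bigID (fun phi : {ffun 'I_N -> 'I_L.+1} => phi n != ord_max)) /=.
rewrite -[leLHS]addr0 lerD //; last first.
  by apply: sumr_ge0 => *; apply: sumr_ge0 => *; exact: normc_ge0.
under eq_bigl => phi do rewrite inE.
apply: ler_sum => phi /andP[phiG nmax].
have [raiseG hit_raise] := raiseP lam nA nmax phiG.
rewrite (bigD1 (raise n phi)) /=; last by rewrite raiseG phiG /hit hit_raise eqxx.
by rewrite lerDl; apply: sumr_ge0 => *; exact: normc_ge0.
Qed.

Lemma aligning_phase (R : realType) (a : R[i]) :
  exists2 v : R[i], Normc.normc v = 1 & a * v^*%R = (Normc.normc a)%:C.
Proof.
have [->|a0] := eqVneq a 0.
  by exists 1; rewrite ?Normc.normc1 // mul0r Normc.normc0.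
have na0 : Normc.normc a != 0 by apply: contra a0 => /eqP/Normc.eq0_normc ->.
exists (a * ((Normc.normc a)^-1)%:C).
  by rewrite Normc.normcM normcRe ger0_norm ?invr_ge0 ?normc_ge0 // divff.
have conjR (r : R) : (r%:C)^*%R = r%:C by exact: conjc_real.
rewrite rmorphM /= conjR mulrA mulcJ -rmorphM /=; congr (_%:C).
by rewrite expr2 mulfK.
Qed.

(** At [mu = 0] separation leaves only the diagonal pairs, each contributing
1. *)
Lemma diagonal_sum (R : realType) N (lam : 'I_N -> R) L (A : {set 'I_N})
    (d : R) (u : 'I_N -> R[i]) :
    (0 < N)%N -> is_min (form_values lam L A) d -> 0 < d ->
    (forall m, Normc.normc (u m) = 1) ->
  \sum_(psi in multi_index L A)
    \sum_(phi in multi_index L A |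
        0 + frequency lam A phi - frequency lam A psi == 0)
      phase A u phi * (phase A u psi)^*%R = #|multi_index L A|%:R.
Proof.
move=> N0 d_min d0 u1; rewrite -sumr_const; apply: eq_bigr => psi psiG.
rewrite (big_pred1 psi) => [|phi].
  by rewrite mulcJ normc_phase // expr1n.
rewrite add0r /=; apply/andP/eqP => [[phiG eq0]|->]; last by rewrite subrr.
apply: contraTeq eq0 => /(frequency_separated N0 d_min phiG psiG) ge_d.
by rewrite -normr_gt0; exact: lt_le_trans ge_d.
Qed.

(** * The lower bound *)

Unset Implicit Arguments.

Theorem theorem1p5 (R : realType) (k : nat) (hk : (2 <= k)%N) :
  exists2 c : R, 0 < c &
    forall (N : nat) (lam : 'I_N -> R) (f : 'I_N -> R[i])
      (L M : nat) (A : {set 'I_N}) (delta T : R),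
    (1 <= N)%N -> (0 < L)%N -> (0 < M)%N -> (M <= N)%N -> #|A| = M ->
    is_min (form_values lam L A) delta -> 0 < delta -> 1 <= T ->
    exists2 mx : R,
      is_max [set complex.Re (trig_sum lam f x) | x in `[T, 2 * T]] mx &
      mx >= L%:R / L.+1%:R * (\sum_(m in A) Normc.normc (f m))
            - c / (delta * T) ^+ k * (\sum_(n < N) Normc.normc (f n)).
Proof.
have k0 : (0 < k)%N by exact: ltnW.
exists (8 * k%:R ^+ k); first by rewrite mulr_gt0 // exprn_gt0 // ltr0n.
move=> N lam f L M A d T N0 _ _ _ _ d_min d0 T1.
have T0 : 0 < T by exact: lt_le_trans T1.
have [V maxV] := trig_max lam f T0.
exists V => //; case: maxV => [[x0 _ V0] ubV].
set F := \sum_(n < N) Normc.normc (f n).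
have F0 : 0 <= F by apply: sumr_ge0 => n _; exact: normc_ge0.
have normV : `|V| <= F.
  rewrite -V0; apply: (le_trans (abs_Re_le _)).
  apply: (le_trans (normc_sum _ _ _)); apply: ler_sum => n _.
  by rewrite Normc.normcM normc_expi mulr1.
pose u n := s2val (cid2 (aligning_phase (f n))).
have u1 n : Normc.normc (u n) = 1 by rewrite /u; case: cid2.
have fu n : f n * (u n)^*%R = (Normc.normc (f n))%:C by rewrite /u; case: cid2.
pose G := multi_index L A.
pose nu : {ffun 'I_N -> 'I_L.+1} -> R := frequency lam A.
have G0 : (0 < #|G|)%N.
  apply/card_gt0P; exists [ffun=> ord0].
  by apply/multi_indexP => m _; rewrite ffunE.
(* Dominates every frequency met below: |mu| <= \sum_n |lam n| and each of the
   two terms nu is at most L times that sum. *)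
pose B : R := (L%:R *+ 2 + 1) * \sum_n `|lam n|.
have bound mu phi psi : `|mu| <= \sum_n `|lam n| -> `|mu + nu phi - nu psi| <= B.
  move=> mu_le; apply: (le_trans (ler_normB _ _)).
  have := ler_normD mu (nu phi); have := frequency_le lam A phi.
  have := frequency_le lam A psi; rewrite /B /nu; lra.
have [P [x [P0 xT decay]]] := sampling_points B k0 T0.
pose eps : R := 4 * k%:R ^+ k / (d * T) ^+ k.
have eps0 : 0 <= eps.
  by rewrite divr_ge0 ?mulr_ge0 ?exprn_ge0 ?mulr_ge0 // ltW.
have approx mu := sampled_square_approx (z := phase A u) (mu := mu) hk T0 d0 decay
  (fun phi _ => normc_phase A phi u1) (frequency_separated N0 d_min).
pose q p := Normc.normc (trig_poly G (phase A u) nu (x p)) ^+ 2.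
have mass : `|\sum_p q p - #|P|%:R * #|G|%:R| <= #|P|%:R * #|G|%:R * eps.
  have := approx 0; rewrite (diagonal_sum N0 d_min d0 u1) => H.
  rewrite -normcRe rmorphB rmorphM rmorph_sum !rmorph_nat /=.
  apply: (le_trans _ (H _)).
    by under [in leRHS]eq_bigr do rewrite mulr0 mul0r expi0 mulr1.
  move=> phi psi phiG psiG ne0; rewrite bound ?normr0 ?sumr_ge0 // andbT.
  rewrite add0r in ne0 *; apply: (frequency_separated N0 d_min) => //.
  by apply: contraNneq ne0 => ->; rewrite subrr.
pose D n := \sum_(psi in G) \sum_(phi in G | lam n + nu phi - nu psi == 0)
  phase A u phi * (phase A u psi)^*%R.
pose W n := \sum_p (q p)%:C * expi (2 * pi * lam n * x p).
have WD n : Normc.normc (W n - #|P|%:R * D n) <= #|P|%:R * #|G|%:R * eps.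
  apply: (approx (lam n)) => phi psi phiG psiG ne0.
  rewrite bound ?andbT; last first.
    by rewrite (bigD1 n) //= lerDl sumr_ge0.
  by case: (shifted_frequency n phi psi d_min) => // -[/eqP]; rewrite (negPf ne0).
have avgF : \sum_p q p * complex.Re (trig_sum lam f (x p)) =
    \sum_n complex.Re (f n * W n).
  rewrite -Re_sum; under eq_bigr do rewrite -ReMl.
  rewrite -Re_sum; congr complex.Re.
  under eq_bigr do rewrite /trig_sum mulr_sumr.
  rewrite exchange_big; apply: eq_bigr => n _ /=; rewrite mulr_sumr.
  by apply: eq_bigr => p _; rewrite mulrCA.
have upper : \sum_p q p * complex.Re (trig_sum lam f (x p)) <= V * \sum_p q p.
  rewrite mulr_sumr; apply: ler_sum => p _; rewrite mulrC ler_wpM2r ?sqr_ge0 //.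
  by apply: ubV; exists (x p) => //; exact: xT.
pose S := \sum_(m in A) Normc.normc (f m).
have lower : #|P|%:R * #|G|%:R * (L%:R / L.+1%:R * S - eps * F) <=
    \sum_n complex.Re (f n * W n).
  have -> : #|P|%:R * #|G|%:R * (L%:R / L.+1%:R * S - eps * F) = \sum_n
      (#|P|%:R * (#|G|%:R *
         (if n \in A then L%:R / L.+1%:R * Normc.normc (f n) else 0))
       - Normc.normc (f n) * (#|P|%:R * #|G|%:R * eps)).
    rewrite sumrB -!mulr_sumr -mulr_suml -big_mkcond -mulr_sumr -/F -/S; ring.
  apply: ler_sum => n _.
  have -> : f n * W n =
      (#|P|%:R : R)%:C * (f n * D n) + f n * (W n - #|P|%:R * D n).
    by rewrite rmorph_nat; ring.
  rewrite ReD ReMl lerD //.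
    by rewrite ler_wpM2l //; exact: (resonance d_min d0 u1 (fu n)).
  rewrite lerNl; apply: (le_trans (ler_norm _)); rewrite normrN.
  by apply: (le_trans (abs_Re_le _)); rewrite Normc.normcM ler_wpM2l ?normc_ge0.
have PG0 : 0 < #|P|%:R * #|G|%:R :> R by rewrite mulr_gt0 // ltr0n.
(* The error made by replacing the mass of the weight with its main term: here
   |V| <= F is needed, as V may be negative. *)
have massV : V * (\sum_p q p - #|P|%:R * #|G|%:R) <= F * (#|P|%:R * #|G|%:R * eps).
  by apply: (le_trans (ler_norm _)); rewrite normrM ler_pM.
rewrite -/S -(ler_pM2l PG0).
have -> : 8 * k%:R ^+ k / (d * T) ^+ k = 2 * eps by rewrite /eps; ring.
rewrite -avgF in lower; move: massV (le_trans lower upper).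
move: (\sum_p q p) (#|P|%:R * #|G|%:R : R) (L%:R / L.+1%:R * S) => Q m s; lra.
Qed.
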